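(* Let $0<d_1<\cdots<d_k<n$ be integers. The following decomposition holds: $$\mathbb{F}_{d_1<\cdots<d_k}(\mathbb{C}^n)^T=\bigsqcup_{\mathbf{M}\in\mathcal{M}^{d_1,\dots,d_k}_n}\mathbb{V}_{\mathbf{M}}(\mathcal{F}_{\mathbf{M}}).$$
   Context: A decomposition of a topological space $X$ is a family of pairwise disjoint, locally closed subsets whose union is $X$; here $\mathbb{F}_{d_1<\cdots<d_k}(\mathbb{C}^n)^T$ carries the subspace topology from the scheme $\mathbb{F}_{d_1<\cdots<d_k}(\mathbb{C}^n)$. $[n]=\{1,\dots,n\}$ and $\binom{[n]}{d}$ is the set of $d$-element subsets of $[n]$. A matroid of rank $d$ on $n$ elements is a pair $M=([n],\mathcal{B})$ with $\emptyset\neq\mathcal{B}\subset\binom{[n]}{d}$ such that for all $I,J\in\mathcal{B}$ and $i\in I\setminus J$ there is $j\in J\setminus I$ with $(I\setminus\{i\})\cup\{j\}\in\mathcal{B}$. $\mathcal{M}^d_n$ is the set of such matroids, and $\mathcal{M}^{d_1,\dots,d_k}_n=\mathcal{M}^{d_1}_n\times\cdots\times\mathcal{M}^{d_k}_n$; its elements are called plurimatroids. $G(d,n)$ is the Grassmannian of $d$-dimensional subspaces of $\mathbb{C}^n$ (row vectors), with Plücker coordinates $(p_I)_{I\in\binom{[n]}{d}}$. For $M=([n],\mathcal{B})\in\mathcal{M}^d_n$, $G_M=\{W\in G(d,n): p_I(W)\neq0\Leftrightarrow I\in\mathcal{B}\}$. The flag variety is $\mathbb{F}_{d_1<\cdots<d_k}(\mathbb{C}^n)=\{W_1\subset\cdots\subset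 W_k\subset\mathbb{C}^n:\dim W_i=d_i\}\subset\prod_{i}G(d_i,n)$. The thin Schubert cell of $\mathbf{M}=(M_1,\dots,M_k)$ is $\mathbb{F}_{\mathbf{M}}=\left(\prod_{i=1}^kG_{M_i}\right)\cap\mathbb{F}_{d_1<\cdots<d_k}(\mathbb{C}^n)$, an affine locally closed subvariety. $T<\mathrm{GL}_n(\mathbb{C})$ is the torus of invertible diagonal matrices, acting on the right by $(W_1,\dots,W_k)\cdot g=(W_1g,\dots,W_kg)$; each $\mathbb{F}_{\mathbf{M}}$ is $T$-invariant, and all points of a nonempty $\mathbb{F}_{\mathbf{M}}$ have the same isotropy group $\mathrm{Stab}_T(\mathbb{F}_{\mathbf{M}})$. Put $T_{\mathbf{M}}=T/\mathrm{Stab}_T(\mathbb{F}_{\mathbf{M}})$. $\mathcal{F}_{\mathbf{M}}$ denotes the universal geometric quotient (in the sense of Mumford's GIT; it exists) of $\mathbb{F}_{\mathbf{M}}$ by $T_{\mathbf{M}}$, with quotient morphism $\pi:\mathbb{F}_{\mathbf{M}}\to\mathcal{F}_{\mathbf{M}}$; $\mathcal{F}_{\mathbf{M}}=\emptyset$ if $\mathbb{F}_{\mathbf{M}}=\emptyset$. All varieties are viewed as schemes, and points are scheme-theoretic points. $\mathbb{F}_{d_1<\cdots<d_k}(\mathbb{C}^n)^T$ is the set of scheme-theoretic points $\eta$ of the flag variety that are $T$-invariant, i.e. such that $\overline{\{\eta\}}$ is $T$-invariant. The map $\mathbb{V}_{\mathbf{M}}:\mathcal{F}_{\mathbf{M}}\to\mathbb{F}_{d_1<\cdots<d_k}(\mathbb{C}^n)^T$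 sends $y$ to the point $\eta$ with $\overline{\{\eta\}}=\overline{\pi^{-1}(Y)}$, where $Y=\overline{\{y\}}\subset\mathcal{F}_{\mathbf{M}}$ and the closures of $\{\eta\}$ and $\pi^{-1}(Y)$ are taken in the flag variety (the set $\overline{\pi^{-1}(Y)}$ is $T$-invariant and irreducible, so $\eta$ is its generic point). *)

(* Defs.v *)
From HB Require Import structures.
From mathcomp Require Import all_boot all_order all_algebra.
From mathcomp Require Import all_classical all_reals topology.
From mathcomp Require Import complex.
From mathcomp Require Import -(notations) mpoly.

Set Implicit Arguments.
Unset Strict Implicit.
Unset Printing Implicit Defensive.

Import GRing.Theory.
Local Open Scope classical_set_scope.
Local Open Scope ring_scope.

(** Varieties over C are Serre's spaces with a sheaf of C-valued functions; the
    scheme attached to a variety X is t(X) of Hartshorne, II.2.6: its points are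
    the irreducible closed subsets of X. Topological spaces, closures and open
    sets below are those of the Zariski topology. *)

(** ** General topology *)

Definition irreducible (X : topologicalType) (A : set X) : Prop :=
  A !=set0 /\
  forall F G : set X, closed F -> closed G ->
    A `<=` F `|` G -> A `<=` F \/ A `<=` G.

Definition locally_closed (X : topologicalType) (A : set X) : Prop :=
  exists U F : set X, [/\ open U, closed F & A = U `&` F].

(** [P] decomposes [A], a subset of [X] with the subspace topology. *)
Definition decomposition_of (X : topologicalType) (A : set X) (J : Type)
    (P : J -> set X) : Prop :=
  [/\ A = \bigcup_j P j,
      trivIset setT P &
      forall j, locally_closed ((set_val : A -> X) @^-1` P j)].

Lemma irreducible_closure (X : topologicalType) (A : set X) :
  irreducible A -> irreducible (closure A).
Proof.
move=> [[a Aa] irrA]; split; first by exists a; exact: subset_closure.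
move=> F G cF cG sFG.
have [sF|sG] := irrA F G cF cG (subset_trans (@subset_closure _ A) sFG).
- by left; rewrite (closure_id F).1 //; exact: closure_subset.
- by right; rewrite (closure_id G).1 //; exact: closure_subset.
Qed.

Lemma irreducible_set1 (X : topologicalType) (x : X) : irreducible [set x].
Proof.
split; first by exists x.
by move=> F G _ _ /(_ x erefl) [Fx|Gx]; [left|right] => _ ->.
Qed.

Lemma irreducible_image (X Y : topologicalType) (f : X -> Y) (A : set X) :
  continuous f -> irreducible A -> irreducible (f @` A).
Proof.
move=> /continuous_closedP cl [[a Aa] irrA]; split; first by exists (f a), a.
move=> F G cF cG; rewrite image_sub => sFG.
have [sF|sG] := irrA _ _ (cl F cF) (cl G cG) sFG.
- by left; rewrite image_sub.
- by right; rewrite image_sub.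
Qed.

(** ** The points of the scheme attached to a variety *)

Record spoint (X : topologicalType) := SPoint {
  spoint_set :> set X;
  spoint_closed : closed spoint_set;
  spoint_irr : irreducible spoint_set }.

Lemma spoint_inj (X : topologicalType) : injective (@spoint_set X).
Proof.
move=> [A cA iA] [B cB iB] /= AB; rewrite {}AB in cA iA *.
by congr SPoint; exact: Prop_irrelevance.
Qed.

Section SpointTopology.
Variable X : topologicalType.

HB.instance Definition _ := gen_eqMixin (spoint X).
HB.instance Definition _ := gen_choiceMixin (spoint X).

Definition spoint_open (O : set (spoint X)) : Prop :=
  exists2 U : set X, open U & O = [set z : spoint X | z `&` U !=set0].

Let spoint_openT : spoint_open setT.
Proof.
exists setT; first exact: openT.
by apply/seteqP; split=> // z _ /=; rewrite setIT; case: (spoint_irr z).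
Qed.

Let spoint_openI : setI_closed spoint_open.
Proof.
move=> _ _ [U oU ->] [V oV ->]; exists (U `&` V); first exact: openI.
apply/seteqP; split=> z /=; last first.
  by move=> [x [zx [Ux Vx]]]; split; exists x.
move=> [[x [zx Ux]] [y [zy Vy]]]; apply: contrapT => nUV.
have [_ /(_ (~` U) (~` V))] := spoint_irr z.
rewrite !closedC => /(_ oU oV) [w zw|/(_ x zx)//|/(_ y zy)//].
by rewrite -setCI => UVw; apply: nUV; exists w.
Qed.

Let spoint_open_bigU (J : Type) (f : J -> set (spoint X)) :
  (forall j, spoint_open (f j)) -> spoint_open (\bigcup_j f j).
Proof.
move=> /(_ _)/cid2 of_; exists (\bigcup_j s2val (of_ j)).
  by apply: bigcup_open => j _; exact: s2valP (of_ j).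
apply/seteqP; split=> z /=.
  move=> [j _]; rewrite (s2valP' (of_ j)) => -[x [zx Ux]].
  by exists x; split=> //; exists j.
move=> [x [zx [j _ Ux]]]; exists j => //.
by rewrite (s2valP' (of_ j)); exists x.
Qed.

HB.instance Definition _ := isOpenTopological.Build (spoint X)
  spoint_openT spoint_openI spoint_open_bigU.

Lemma spoint_openE (O : set (spoint X)) : open O = spoint_open O.
Proof. by []. Qed.

Lemma closure_spoint (z : spoint X) :
  closure [set z] = [set t : spoint X | t `<=` z].
Proof.
apply/seteqP; split=> t /=.
  move=> clt x tx; apply: contrapT => nzx.
  have : nbhs t [set s : spoint X | s `&` ~` z !=set0].
    apply: open_nbhs_nbhs; split; last by exists x.
    rewrite spoint_openE; exists (~` z) => //.
    by rewrite openC; exact: spoint_closed.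
  by move=> /clt [_ [-> [y []]]].
move=> tz O; rewrite nbhsE => -[O' [oO' O't] sO].
exists z; split=> //; apply: sO.
move: oO' O't; rewrite spoint_openE => -[U oU ->] /= [x [tx Ux]].
by exists x; split=> //; exact: tz.
Qed.

(** The scheme point given by the closed point [x]. *)
Definition closed_spoint (x : X) : spoint X :=
  SPoint (@closed_closure _ [set x])
         (irreducible_closure (irreducible_set1 x)).

End SpointTopology.

(** The map on scheme points induced by a morphism sends a point with closure Z
    to the generic point of the closure of the image of Z. *)
Definition spoint_map (X Y : topologicalType) (f : X -> Y) (cf : continuous f)
    (z : spoint X) : spoint Y :=
  SPoint (@closed_closure _ (f @` z))
         (irreducible_closure (irreducible_image cf (spoint_irr z))).

(** ** Spaces with functions and varieties over the complex numbers *)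

Section Varieties.
Variable R : realType.
Local Notation C := R[i].

(** [reg U f]: the restriction of [f] to the open set [U] is a section over [U]
    of the structure sheaf; the values of [f] outside [U] are irrelevant. *)
Record cspace := CSpace {
  carrier :> topologicalType;
  reg : set carrier -> (carrier -> C) -> Prop;
  reg_restrict : forall U V f, open U -> open V -> V `<=` U ->
    reg U f -> reg V f;
  reg_glue : forall U f, open U ->
    (forall x, U x -> exists V g,
      [/\ open V, V x, V `<=` U, reg V g & forall v, V v -> f v = g v]) ->
    reg U f }.

Definition is_morphism (X Y : cspace) (f : X -> Y) : Prop :=
  continuous f /\
  forall (V : set Y) g, open V -> reg V g -> reg (f @^-1` V) (g \o f).

Record cmor (X Y : cspace) := CMor {
  cmor_fun :> X -> Y;
  cmorP : is_morphism cmor_fun }.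

Definition cmor_continuous (X Y : cspace) (f : cmor X Y) : continuous f :=
  proj1 (cmorP f).

Definition isomorphic (X Y : cspace) : Prop :=
  exists (f : cmor X Y) (g : cmor Y X), cancel f g /\ cancel g f.

(** *** Subspaces, with the induced reduced structure *)

Section Subspace.
Variables (X : cspace) (A : set X).

Definition sub_reg (U : set A) (f : A -> C) : Prop :=
  forall a, U a -> exists (V : set X) (g : X -> C),
    [/\ open V, V (set_val a), reg V g &
        forall b : A, V (set_val b) -> U b /\ f b = g (set_val b)].

Let sub_restrict (U V : set A) f : open U -> open V -> V `<=` U ->
  sub_reg U f -> sub_reg V f.
Proof.
move=> _ [W oW <-] sVU regU a Va.
have [U' [g [oU' U'a regg fg]]] := regU a (sVU _ Va).
exists (U' `&` W), g; split=> //; first exact: openI.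
- by apply: reg_restrict regg => //; exact: openI.
- by move=> b [U'b Wb]; split=> //; case: (fg b U'b).
Qed.

Let sub_glue (U : set A) f : open U ->
  (forall x, U x -> exists V g,
    [/\ open V, V x, V `<=` U, sub_reg V g & forall v, V v -> f v = g v]) ->
  sub_reg U f.
Proof.
move=> _ locf a Ua; have [V [g [_ Va sVU regg fg]]] := locf a Ua.
have [W [h [oW Wa regh gh]]] := regg a Va.
exists W, h; split=> // b Wb; have [Vb <-] := gh b Wb.
by split; [exact: sVU | exact: fg].
Qed.

Definition reduced_sub : cspace := @CSpace A sub_reg sub_restrict sub_glue.

Let set_val_morphism : @is_morphism reduced_sub X set_val.
Proof.
split; first exact: initial_continuous.
by move=> V g oV regg a Va; exists V, g.
Qed.

Definition sub_incl : cmor reduced_sub X := CMor set_val_morphism.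

End Subspace.

(** *** Spaces described by multihomogeneous coordinates

    A point of [S] is given by its coordinates [c s : I -> C]; for each block
    [b \in B] of coordinates, the coordinates in [b] matter only up to a common
    factor. No block gives affine coordinates, one block containing all the
    coordinates gives homogeneous coordinates on a projective space. *)

Definition cpoly (I : finType) := mpoly #|I| C.

Definition coord_space (I : finType) (B : seq {set I}) (S : Type)
    (c : S -> I -> C) : Type := S.

Section CoordinateSpace.
Variables (I : finType) (B : seq {set I}) (S : Type) (c : S -> I -> C).

Definition eval_at (p : cpoly I) (s : S) : C :=
  meval (fun j => c s (enum_val j)) p.

Definition multihomogeneous (p : cpoly I) (e : {set I} -> nat) : Prop :=
  forall m, m \in msupp p -> forall b, b \in B ->
    (\sum_(i in b) m (enum_rank i))%N = e b.

Local Notation T := (coord_space B c).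

HB.instance Definition _ := gen_eqMixin T.
HB.instance Definition _ := gen_choiceMixin T.

Definition zariski_open (U : set T) : Prop :=
  exists P : set (cpoly I),
    (forall p, P p -> exists e, multihomogeneous p e) /\
    U = [set s | exists2 p, P p & eval_at p s != 0].

Let zariski_openT : zariski_open setT.
Proof.
exists [set mpolyC _ 1]; split.
  move=> _ ->; exists (fun=> 0%N) => m; rewrite msupp1 inE => /eqP-> b _.
  by rewrite big1 // => i _; rewrite mnm0E.
apply/seteqP; split=> // s _; exists (mpolyC _ 1) => //.
by rewrite /eval_at mevalC oner_eq0.
Qed.

Lemma multihomogeneousM p q e e' : multihomogeneous p e ->
  multihomogeneous q e' -> multihomogeneous (p * q) (fun b => e b + e' b)%N.
Proof.
move=> hp hq m /msuppM_le /allpairsP[[m1 m2] /= [m1p m2q ->]] b Bb.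
rewrite -(hp m1 m1p b Bb) -(hq m2 m2q b Bb) -big_split /=.
by apply: eq_bigr => i _; rewrite mnmDE.
Qed.

Let zariski_openI : setI_closed zariski_open.
Proof.
move=> _ _ [P [hP ->]] [Q [hQ ->]].
exists [set r | exists p q, [/\ P p, Q q & r = p * q]]; split.
  move=> _ [p [q [/hP[e he] /hQ[e' he'] ->]]].
  by exists (fun b => e b + e' b)%N; exact: multihomogeneousM.
apply/seteqP; split=> s /=.
  move=> [[p Pp ps] [q Qq qs]]; exists (p * q); first by exists p, q.
  by rewrite /eval_at mevalM mulf_neq0.
move=> [_ [p [q [Pp Qq ->]]]]; rewrite /eval_at mevalM mulf_eq0 negb_or.
by move=> /andP[ps qs]; split; [exists p | exists q].
Qed.

Let zariski_open_bigU (J : Type) (f : J -> set T) :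
  (forall j, zariski_open (f j)) -> zariski_open (\bigcup_j f j).
Proof.
move=> /(_ _)/cid-of_; exists (\bigcup_j sval (of_ j)); split.
  by move=> p [j _ jp]; case: (svalP (of_ j)) => hj _; exact: hj.
apply/seteqP; split=> s /=.
  move=> [j _]; case: (svalP (of_ j)) => _ {1}-> [p jp ps].
  by exists p => //; exists j.
move=> [p [j _ jp] ps]; exists j => //.
by case: (svalP (of_ j)) => _ ->; exists p.
Qed.

HB.instance Definition _ := isOpenTopological.Build T
  zariski_openT zariski_openI zariski_open_bigU.

Lemma zariski_openE (U : set T) : open U = zariski_open U.
Proof. by []. Qed.

Definition coord_reg (U : set T) (f : T -> C) : Prop :=
  forall s, U s -> exists (V : set T) (p q : cpoly I) (e : {set I} -> nat),
    [/\ open V /\ V s, V `<=` U, multihomogeneous p e, multihomogeneous q e &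
        forall v, V v -> eval_at q v != 0 /\ f v = eval_at p v / eval_at q v].

Let coord_restrict (U V : set T) f : open U -> open V -> V `<=` U ->
  coord_reg U f -> coord_reg V f.
Proof.
move=> oU oV sVU regU s Vs.
have [W [p [q [e [[oW Ws] sWU hp hq fpq]]]]] := regU s (sVU _ Vs).
exists (W `&` V), p, q, e; split=> //; last by move=> v [/fpq].
by split=> //; exact: openI.
Qed.

Let coord_glue (U : set T) f : open U ->
  (forall x, U x -> exists V g,
    [/\ open V, V x, V `<=` U, coord_reg V g & forall v, V v -> f v = g v]) ->
  coord_reg U f.
Proof.
move=> _ locf s Us; have [V [g [_ Vs sVU regg fg]]] := locf s Us.
have [W [p [q [e [oW sWV hp hq gpq]]]]] := regg s Vs.
exists W, p, q, e; split=> // [|v Wv]; first exact: subset_trans sWV sVU.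
by rewrite fg; [exact: gpq | exact: sWV].
Qed.

Definition coord_variety : cspace := @CSpace T coord_reg coord_restrict coord_glue.

End CoordinateSpace.

(** *** Varieties: reduced schemes of finite type over C

    They may be reducible; separatedness is not required, as in the definition
    of a geometric quotient. *)

Definition affine_space (m : nat) : cspace :=
  @coord_variety 'I_m [::] ('I_m -> C) id.

Definition affine_variety (X : cspace) : Prop :=
  exists (m : nat) (P : set (cpoly 'I_m)),
    isomorphic X
      (@reduced_sub (affine_space m) [set x | forall p, P p -> eval_at id p x = 0]).

Definition variety (X : cspace) : Prop :=
  exists (r : nat) (U : 'I_r -> set X),
    (forall i, open (U i) /\ affine_variety (reduced_sub (U i))) /\
    \bigcup_i U i = setT.

(** ** Geometric quotients (Mumford, GIT, Definitions 0.6 and 0.7) *)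

Definition geometric_quotient (G : Type) (X Y : cspace) (act : X -> G -> X)
    (f : cmor X Y) : Prop :=
  [/\ forall x g, f (act x g) = f x,
      (forall y, exists x, f x = y) /\
        (forall x x', f x = f x' -> exists g, x' = act x g),
      forall U : set Y, open (f @^-1` U) -> open U &
      forall (U : set Y) (h : X -> C), open U -> reg (f @^-1` U) h ->
        (forall x g, U (f x) -> h (act x g) = h x) ->
        exists2 h' : Y -> C, reg U h' & forall x, U (f x) -> h x = h' (f x)].

Definition is_pullback (X Y X' Y' : cspace) (f : cmor X Y) (u : cmor Y' Y)
    (p : cmor X' X) (q : cmor X' Y') : Prop :=
  [/\ variety X',
      forall x', f (p x') = u (q x') &
      forall (Z : cspace) (a : cmor Z X) (b : cmor Z Y'), variety Z ->
        (forall z, f (a z) = u (b z)) ->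
        exists2 w : cmor Z X', (forall z, p (w z) = a z /\ q (w z) = b z) &
          forall w' : cmor Z X', (forall z, p (w' z) = a z /\ q (w' z) = b z) ->
            w' =1 w].

Definition universal_geometric_quotient (G : Type) (X Y : cspace)
    (act : X -> G -> X) (f : cmor X Y) : Prop :=
  [/\ variety Y,
      geometric_quotient act f &
      forall (X' Y' : cspace) (u : cmor Y' Y) (p : cmor X' X) (q : cmor X' Y')
          (act' : X' -> G -> X'),
        variety Y' -> is_pullback f u p q ->
        (forall x' g, p (act' x' g) = act (p x') g /\ q (act' x' g) = q x') ->
        geometric_quotient act' q].

End Varieties.

Arguments cmor_continuous {R X Y} f.

(** ** Grassmannians, flag varieties, matroids and thin Schubert cells *)

Section Flags.
Variables (R : realType) (n : nat).
Local Notation C := R[i].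

Definition dsubset (d : nat) := {I : {set 'I_n} | #|I| == d}.

Definition is_matroid (d : nat) (B : {set {set 'I_n}}) : bool :=
  [&& B != finset.set0,
      [forall I in B, #|I| == d] &
      [forall I in B, forall J in B, forall i in I :\: J,
        exists j in J :\: I, (j |: (I :\ i)) \in B]].

Definition matroid (d : nat) := {B : {set {set 'I_n}} | is_matroid d B}.

Definition grass (d : nat) := {W : {vspace 'rV[C]_n} | \dim W == d}.

(** Computed from a chosen basis of [W], hence defined up to a common nonzero
    factor when [I] varies. *)
Definition plucker (d : nat) (W : grass d) (I : dsubset d) : C :=
  \det (\matrix_(a < d, b < d)
    (vbasis (val W))`_a 0 (enum_val (cast_ord (esym (eqP (valP I))) b))).

Definition grass_cell (d : nat) (M : matroid d) : set (grass d) :=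
  [set W | forall I : dsubset d, plucker W I != 0 <-> val I \in val M].

Definition is_torus (g : 'M[C]_n) : bool := is_diag_mx g && (g \in unitmx).

Definition torus := {g : 'M[C]_n | is_torus g}.

Definition mulg_vspace (W : {vspace 'rV[C]_n}) (g : torus) : {vspace 'rV[C]_n} :=
  (linfun (mulmxr (val g)) @: W)%VS.

Lemma torus_unit (g : torus) : val g \in unitmx.
Proof. by case/andP: (valP g). Qed.

Lemma torus_inv_subproof (g : torus) : is_torus (invmx (val g)).
Proof.
rewrite /is_torus unitmx_inv torus_unit andbT.
have /andP[/is_diag_mxP dg ug] := valP g.
apply/is_diag_mxP => i j ij.
have /matrixP/(_ i j) := mulmxV ug.
rewrite !mxE (bigD1 i) //= big1 ?addr0 => [|l li]; last first.
  by rewrite dg ?mul0r // eq_sym.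
have /matrixP/(_ i i) := mulmxV ug.
rewrite !mxE (bigD1 i) //= big1 ?addr0 => [|l li]; last first.
  by rewrite dg ?mul0r // eq_sym.
rewrite eqxx; move: ij; rewrite -val_eqE /= => /negPf ->.
move=> gi1 /eqP; rewrite mulf_eq0 => /orP[/eqP gi0|/eqP//].
by move: gi1; rewrite gi0 mul0r => /esym/eqP; rewrite oner_eq0.
Qed.

Definition torus_inv (g : torus) : torus := exist is_torus _ (torus_inv_subproof g).

Lemma mulg_vspaceK (g : torus) :
  cancel (mulg_vspace^~ g) (mulg_vspace^~ (torus_inv g)).
Proof.
move=> W; rewrite /mulg_vspace -limg_comp -[RHS]lim1g; congr (_ @: _)%VS.
apply/lfunP => v; rewrite comp_lfunE !lfunE /=.
by rewrite -mulmxA mulmxV ?torus_unit // mulmx1.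
Qed.

Lemma dim_mulg_vspace (W : {vspace 'rV[C]_n}) (g : torus) :
  \dim (mulg_vspace W g) = \dim W.
Proof.
have le (V : {vspace 'rV[C]_n}) h : (\dim (mulg_vspace V h) <= \dim V)%N.
  by rewrite -(limg_ker_dim (linfun (mulmxr (val h))) V) leq_addl.
by apply/eqP; rewrite eqn_leq le -{1}(mulg_vspaceK g W) le.
Qed.

Lemma grass_act_subproof (d : nat) (W : grass d) (g : torus) :
  \dim (mulg_vspace (val W) g) == d.
Proof. by rewrite dim_mulg_vspace (valP W). Qed.

Definition grass_act (d : nat) (W : grass d) (g : torus) : grass d :=
  exist (fun V => \dim V == d) _ (grass_act_subproof W g).

Lemma grass_actK (d : nat) (g : torus) :
  cancel (@grass_act d ^~ g) (@grass_act d ^~ (torus_inv g)).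
Proof. by move=> W; apply: val_inj; exact: mulg_vspaceK. Qed.

Lemma plucker_act (d : nat) (W : grass d) (g : torus) (I : dsubset d) :
  plucker (grass_act W g) I != 0 -> plucker W I != 0.
Proof.
set f := fun b : 'I_d => enum_val (cast_ord (esym (eqP (valP I))) b).
have dW : \dim (val W) = d by exact/eqP/(valP W).
pose A : 'M[C]_(d, n) := \matrix_a (vbasis (val W))`_a.
have row_A (v : 'rV[C]_n) : v \in val W -> exists u : 'rV_d, v = u *m A.
  move=> vW; exists (\row_a coord (vbasis (val W)) (cast_ord (esym dW) a) v).
  rewrite {1}(coord_vbasis vW) mulmx_sum_row.
  rewrite (reindex (cast_ord (esym dW))) /=; last first.
    by exists (cast_ord dW) => a _; rewrite ?cast_ordK ?cast_ordKV.
  by apply: eq_bigr => a _; rewrite !mxE rowK.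
pose A' : 'M[C]_(d, n) := \matrix_a (vbasis (val (grass_act W g)))`_a.
have row_A' (a : 'I_d) : exists u : 'rV_d, row a A' = u *m (A *m val g).
  have : row a A' \in val (grass_act W g).
    rewrite rowK; apply: vbasis_mem; apply: mem_nth.
    by rewrite size_tuple dim_mulg_vspace dW.
  move=> /memv_imgP[v /row_A[u ->] ->]; exists u.
  by rewrite lfunE /= mulmxA.
have [P PE] : exists P : 'M_d, A' = P *m (A *m val g).
  exists (\matrix_a sval (cid (row_A' a))).
  by apply/row_matrixP => a; rewrite row_mul rowK -(svalP (cid (row_A' a))).
have E1 : plucker (grass_act W g) I = \det (colsub f A').
  by congr (\det _); apply/matrixP => a b; rewrite !mxE.
have E2 : plucker W I = \det (colsub f A).
  by congr (\det _); apply/matrixP => a b; rewrite !mxE.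
have gD : colsub f (A *m val g) = colsub f A *m diag_mx (\row_b val g (f b) (f b)).
  have /andP[/is_diag_mxP dg _] := valP g.
  apply/matrixP => a b; rewrite mul_mx_diag !mxE (bigD1 (f b)) //= big1 ?addr0 //.
    by rewrite !mxE.
  by move=> l lb; rewrite dg ?mulr0.
have E3 : colsub f A' = P *m colsub f (A *m val g).
  by rewrite PE; apply/matrixP => a b; rewrite !mxE; apply: eq_bigr => c _; rewrite !mxE.
rewrite E1 E2 E3 gD !det_mulmx !mulf_eq0 !negb_or.
by move=> /andP[_ /andP[]].
Qed.

Lemma grass_cell_act (d : nat) (M : matroid d) (W : grass d) (g : torus) :
  grass_cell M W -> grass_cell M (grass_act W g).
Proof.
move=> MW I; rewrite -MW; split; first exact: plucker_act.
by move=> nz; apply: (@plucker_act _ _ (torus_inv g)); rewrite grass_actK.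
Qed.

Variables (k : nat) (d : 'I_k -> nat).

Definition plurimatroid := forall i, matroid (d i).

(** The product of the Grassmannians, embedded by Plücker coordinates in a
    product of projective spaces. *)

Definition plucker_index := {i : 'I_k & dsubset (d i)}.

Definition plucker_coord (W : forall i, grass (d i)) (z : plucker_index) : C :=
  plucker (W (tag z)) (tagged z).

Definition plucker_blocks : seq {set plucker_index} :=
  [seq [set z | tag z == i]%SET | i <- enum 'I_k].

Definition grass_prod : cspace R := coord_variety plucker_blocks plucker_coord.

Definition flag_set : set grass_prod :=
  [set W : forall i, grass (d i) |
    forall i j : 'I_k, (i <= j)%N -> (val (W i) <= val (W j))%VS].

Definition flag_variety : cspace R := reduced_sub flag_set.

(** The component [W_i] of a flag. *)
Definition flag_comp (w : flag_variety) (i : 'I_k) : grass (d i) :=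
  (set_val w : forall i, grass (d i)) i.

Definition thin_set (M : plurimatroid) : set flag_variety :=
  [set w | forall i, grass_cell (M i) (flag_comp w i)].

Definition thin_cell (M : plurimatroid) : cspace R := reduced_sub (thin_set M).

Lemma flag_act_subproof (w : flag_variety) (g : torus) :
  (fun i => grass_act (flag_comp w i) g) \in flag_set.
Proof.
apply/mem_set => i j ij; apply: limgS.
by have := set_valP w; exact.
Qed.

Definition flag_act (w : flag_variety) (g : torus) : flag_variety :=
  exist (fun v => v \in flag_set) _ (flag_act_subproof w g).

Lemma thin_act_subproof (M : plurimatroid) (w : thin_cell M) (g : torus) :
  flag_act (set_val w) g \in thin_set M.
Proof. by apply/mem_set => i; apply: grass_cell_act; exact: set_valP w i. Qed.

Definition thin_act (M : plurimatroid) (w : thin_cell M) (g : torus) :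
    thin_cell M :=
  exist (fun v => v \in thin_set M) _ (thin_act_subproof w g).

(** All points of the cell have the same isotropy group. *)
Definition stab (M : plurimatroid) : set torus :=
  [set g | forall w : thin_cell M, thin_act w g = w].

(** T / Stab_T: the set of cosets of the stabilizer. *)
Definition coset_stab (M : plurimatroid) (g : torus) : set torus :=
  [set h : torus | exists2 s, stab M s & val h = val s *m val g].

Definition torus_quo (M : plurimatroid) : Type := set_type (range (coset_stab M)).

Definition torus_quo_repr (M : plurimatroid) (c : torus_quo M) : torus :=
  s2val (cid2 (set_valP c)).

Definition torus_quo_act (M : plurimatroid) (w : thin_cell M)
    (c : torus_quo M) : thin_cell M :=
  thin_act w (torus_quo_repr c).

(** ** The invariant points and the map of the theorem *)

(** A closed subset of the scheme is T-invariant when T maps its closed points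
    to closed points of it. *)
Definition T_invariant (A : set (spoint flag_variety)) : Prop :=
  forall (w : flag_variety) (g : torus),
    A (closed_spoint w) -> A (closed_spoint (flag_act w g)).

Definition invariant_points : set (spoint flag_variety) :=
  [set eta | T_invariant (closure [set eta])].

(** The map is given by its graph: it sends [y] to the point [eta] whose closure,
    in the scheme attached to the flag variety, is that of the preimage under
    [pi] of the closure of [y]. A point is determined by its closure, see
    [closure_spoint]. *)
Definition Vmap_graph (M : plurimatroid) (Q : cspace R) (pi : cmor (thin_cell M) Q)
    (y : spoint Q) (eta : spoint flag_variety) : Prop :=
  closure [set eta] =
  closure (spoint_map (cmor_continuous (sub_incl (thin_set M))) @`
           (spoint_map (cmor_continuous pi) @^-1` closure [set y])).

Definition Vmap_image (M : plurimatroid) (Q : cspace R)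
    (pi : cmor (thin_cell M) Q) : set (spoint flag_variety) :=
  [set eta | exists y, Vmap_graph pi y eta].

End Flags.

Arguments thin_cell R {n k d} M.
Arguments torus_quo_act R {n k d} M w c.
Arguments invariant_points R {n k} d _.
Arguments Vmap_image {R n k d M Q} pi _.

(* Main.v *)
(** A T-invariant point is a T-invariant irreducible closed set [eta] of flags.
    The Plücker coordinates that do not vanish identically on [eta] are nonzero
    simultaneously at some flag of [eta], by irreducibility; hence they form a
    plurimatroid [M], and [M] is the only one whose thin cell is dense in [eta].
    The trace of [eta] on that cell is closed and a union of orbits, so it is
    the preimage of a closed irreducible subset [y] of the quotient, and [eta] is
    the closure of this preimage. Conversely the closure of the preimage of any
    [y] is T-invariant because T acts by homeomorphisms. The points of type [M]
    are cut out by requiring each coordinate to vanish identically on [eta], a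
    closed condition, or not to, an open one. *)

Require Import Defs.
From HB Require Import structures.
From mathcomp Require Import all_boot all_order all_algebra.
From mathcomp Require Import all_classical all_reals topology.
From mathcomp Require Import complex.
From mathcomp Require Import -(notations) mpoly.

Set Implicit Arguments.
Unset Strict Implicit.
Unset Printing Implicit Defensive.

Import GRing.Theory.
Local Open Scope classical_set_scope.
Local Open Scope ring_scope.

(** * Irreducible sets and points of the attached scheme *)

Section IrreducibleSets.
Variable X : topologicalType.
Implicit Types A U : set X.

Lemma irreducible_meetI A U V : irreducible A -> open U -> open V ->
  A `&` U !=set0 -> A `&` V !=set0 -> A `&` (U `&` V) !=set0.
Proof.
move=> [_ irrA] oU oV [x [Ax Ux]] [y [Ay Vy]]; apply: contrapT => nUV.
have [w Aw||] := irrA (~` U) (~` V) (open_closedC oU) (open_closedC oV).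
- by rewrite -setCI => UVw; apply: nUV; exists w.
- by move=> /(_ x Ax).
- by move=> /(_ y Ay).
Qed.

Lemma open_finite_bigcap (J : finType) (P : pred J) (U : J -> set X) :
  (forall j, P j -> open (U j)) -> open [set x | forall j, P j -> U j x].
Proof.
move=> oU; have := bigcap_seq_cond (enum J) U P.
rewrite (_ : \bigcap_(j in _) U j = [set x | forall j, P j -> U j x]) => [->|].
  by exact: (big_ind open openT (@openI X)).
apply/seteqP; split=> x Ux j /=; last by move=> /andP[_]; exact: Ux.
by move=> Pj; apply: Ux; rewrite /= mem_enum.
Qed.

(** Induction along an enumeration of [J]. Openness of the partial intersection is carried along
    because the two-set case requires it. *)
Lemma irreducible_meet_bigcap (J : finType) (P : pred J) A (U : J -> set X) :
  irreducible A -> (forall j, P j -> open (U j) /\ A `&` U j !=set0) ->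
  A `&` [set x | forall j, P j -> U j x] !=set0.
Proof.
move=> irrA oU.
pose Us (s : seq J) := [set x | forall j, j \in s -> P j -> U j x].
suff [_ [x [Ax Ux]]] : open (Us (enum J)) /\ A `&` Us (enum J) !=set0.
  by exists x; split=> // j; apply: Ux; rewrite mem_enum.
elim: (enum J) => [|j s [oUs AUs]].
  rewrite (_ : Us [::] = setT); last by apply/seteqP; split=> // x _.
  by rewrite setIT; split; [exact: openT | exact: irrA.1].
have [Pj|nPj] := boolP (P j); last first.
  suff -> : Us (j :: s) = Us s by [].
  apply/seteqP; split=> x Ux i.
    by move=> si; apply: Ux; rewrite inE si orbT.
  by rewrite inE => /predU1P[->|/Ux//]; rewrite (negPf nPj).
have [oUj AUj] := oU j Pj.
suff -> : Us (j :: s) = U j `&` Us s.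
  by split; [exact: openI | exact: irreducible_meetI].
apply/seteqP; split=> x.
  move=> Ux; split; first by apply: Ux; rewrite ?inE ?eqxx.
  by move=> i si; apply: Ux; rewrite inE si orbT.
by move=> [Ujx Ux] i; rewrite inE => /predU1P[->|/Ux].
Qed.

(** Translates specialization to a closed point in the scheme into membership in a closed set of the
    variety. *)
Lemma closed_spoint_closure (x : X) (z : spoint X) :
  closure [set z] (closed_spoint x) <-> spoint_set z x.
Proof.
rewrite closure_spoint; split=> [|zx]; first by apply; exact: subset_closure.
rewrite /= [X in _ `<=` X]((closure_id z).1 (@spoint_closed _ z)).
by apply: closureS => _ ->.
Qed.

Lemma open_meet U : open U -> open [set z : spoint X | z `&` U !=set0].
Proof. by move=> oU; rewrite spoint_openE; exists U. Qed.

Lemma closed_contained U : closed U -> closed [set z : spoint X | z `<=` U].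
Proof.
move=> cU; rewrite -openC.
rewrite (_ : ~` _ = [set z : spoint X | z `&` ~` U !=set0]).
  by apply: open_meet; rewrite openC.
apply/seteqP; split=> z /=; first exact: nonsubset.
by move=> [x [zx nUx]] /(_ x zx).
Qed.

Lemma closure_minimal A B : closed B -> A `<=` B -> closure A `<=` B.
Proof.
by move=> cB AB; rewrite [B in _ `<=` B]((closure_id B).1 cB); exact: closureS.
Qed.

Lemma irreducible_dense A U : closed A -> irreducible A -> open U ->
  A `&` U !=set0 -> closure (A `&` U) = A.
Proof.
move=> cA [_ irrA] oU [x [Ax Ux]]; apply/seteqP; split.
  by apply: closure_minimal => // y [].
have [y Ay|//|/(_ x Ax)//] :=
  irrA _ _ (@closed_closure _ (A `&` U)) (open_closedC oU).
have [Uy|] := pselect (U y); last by right.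
by left; apply: subset_closure.
Qed.

End IrreducibleSets.

(** [S] need not be open: it is enough that its trace on [A] is a nonempty open subset of [A]. Two
    closed sets covering this trace extend to [X], and adding the complement of [U] to both covers
    all of [A]. *)
Lemma irreducible_preimage_val (X : topologicalType) (S A U : set X) :
  irreducible A -> open U -> A `&` U !=set0 -> A `&` U = A `&` S ->
  irreducible (set_val @^-1` A : set S).
Proof.
move=> [_ irrA] oU [x AUx] AUS; split.
  have [_ Sx] : (A `&` S) x by rewrite -AUS.
  by exists (exist _ x (mem_set Sx)); exact: AUx.1.
move=> F G; rewrite -!openC => -[F' oF' F'E] [G' oG' G'E] sFG.
have cU := open_closedC oU.
have [y Ay|AF|AG] := irrA (~` F' `|` ~` U) (~` G' `|` ~` U)
    (closedU (open_closedC oF') cU) (closedU (open_closedC oG') cU).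
- have [Uy|] := pselect (U y); last by left; right.
  have [_ Sy] : (A `&` S) y by rewrite -AUS.
  pose s : S := exist _ y (mem_set Sy).
  have [Fs|Gs] := sFG s Ay; [left|right]; left=> /= ny.
  + by have : (~` F) s by rewrite -F'E.
  + by have : (~` G) s by rewrite -G'E.
- left=> s As; apply: contrapT => nFs.
  have [_ Us] : (A `&` U) (set_val s).
    by rewrite AUS; split=> //; exact: set_valP.
  have [+|//] := AF _ As; apply.
  by have : (~` F) s by []; rewrite -F'E.
- right=> s As; apply: contrapT => nGs.
  have [_ Us] : (A `&` U) (set_val s).
    by rewrite AUS; split=> //; exact: set_valP.
  have [+|//] := AG _ As; apply.
  by have : (~` G) s by []; rewrite -G'E.
Qed.

(** * Closures in the scheme and closures in the variety *)

Section Correspondence.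
Variables (T X Y : topologicalType) (i : T -> X) (p : T -> Y).
Variables (ci : continuous i) (cp : continuous p).

(** Reduces the scheme-theoretic graph of the map to an equality of closed sets of the variety. The
    link is that the closed points over [y] already determine the closure on the scheme side. *)
Lemma closure_correspondence (y : spoint Y) (eta : spoint X) :
  closure [set eta] =
    closure (spoint_map ci @` (spoint_map cp @^-1` closure [set y])) <->
  spoint_set eta = closure (i @` (p @^-1` y)).
Proof.
set D := _ @` _; set K := closure (i @` _).
have DK : closure D `<=` [set t : spoint X | t `<=` K].
  apply: closure_minimal.
    by apply: closed_contained; exact: closed_closure.
  move=> _ [z + <-]; rewrite /preimage closure_spoint /= => zy.
  apply: closureS => _ [x zx <-]; exists x => //.
  by apply: zy; apply: subset_closure; exists x.
have KD x : (p @^-1` y) x -> D (spoint_map ci (closed_spoint x)).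
  move=> yx; exists (closed_spoint x) => //.
  rewrite /preimage closure_spoint /=.
  apply: closure_minimal; first exact: spoint_closed.
  rewrite image_sub; apply: closure_minimal; last by move=> _ ->.
  by move/continuous_closedP: cp; apply; exact: spoint_closed.
have ix x : spoint_set (spoint_map ci (closed_spoint x)) (i x).
  by apply: subset_closure; exists x => //; exact: subset_closure.
split=> [etaD|etaK].
  have etaE : closure D eta by rewrite -etaD; exact: subset_closure.
  apply/seteqP; split; first exact: DK.
  apply: closure_minimal; first exact: spoint_closed.
  move=> _ [x yx <-].
  have /subset_closure := KD x yx; rewrite -etaD closure_spoint; apply.
  exact: ix.
apply/seteqP; split; last by rewrite closure_spoint etaK.
apply: closure_minimal; first exact: closed_closure.
(* A basic neighbourhood of [eta] comes from an open [U] meeting [eta]; by density [U] contains some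
   [i t] with [t] over [y], and the closed point of [t] maps into that neighbourhood. *)
move=> _ -> N; rewrite nbhsE => -[O [oO Oeta] ON].
move: oO Oeta ON; rewrite spoint_openE => -[U oU ->] /= [x [etax Ux]] UN.
have : nbhs x U by exact: open_nbhs_nbhs.
move: etax; rewrite etaK => /[apply] -[_ [[t yt <-] Ut]].
exists (spoint_map ci (closed_spoint t)); split; first exact: KD.
by apply: UN; exists (i t); split=> //; exact: ix.
Qed.

End Correspondence.

(** * Basis exchange for the rows of a matrix *)

Section SpanRows.
Variables (F : fieldType) (n m : nat) (A : 'M[F]_(n, m)).

Definition span_rows (I : {set 'I_n}) := (\sum_(i in I) <<row i A>>)%MS.

Lemma rank_span_rows I : (\rank (span_rows I) <= #|I|)%N.
Proof.
rewrite (leq_trans (mxrank_sum_leqif _).1) //= -sum1_card.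
by apply: leq_sum => i _; rewrite genmxE rank_leq_row.
Qed.

Lemma rowsub_span_rows p (f : 'I_p -> 'I_n) (I : {set 'I_n}) :
  I = [set f a | a : 'I_p]%SET -> (rowsub f A :=: span_rows I)%MS.
Proof.
move=> ->; apply/eqmxP/andP; split.
  apply/row_subP => a; rewrite row_rowsub.
  by apply: (sumsmx_sup (f a)); rewrite ?imset_f ?genmxE.
apply/sumsmx_subP => _ /imsetP[a _ ->].
by rewrite genmxE -row_rowsub row_sub.
Qed.

(** The rows of [I :\ i] span a space [H] of rank less than [d], so some row of [J] lies outside
    [H]; adjoining it brings the rank back to [d]. *)
Lemma span_rows_exchange (d : nat) (I J : {set 'I_n}) i :
  #|I| = d -> \rank (span_rows I) = d -> \rank (span_rows J) = d ->
  i \in I :\: J ->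
  exists2 j, j \in J :\: I & \rank (span_rows (j |: I :\ i)) = d.
Proof.
move=> cI rI rJ /setDP[iI iJ]; pose H := span_rows (I :\ i).
have cIi : #|I :\ i|.+1 = d by rewrite -cI (cardsD1 i I) iI.
have rHd : (\rank H < d)%N by rewrite -cIi ltnS rank_span_rows.
have [/forall_inP JH|/forall_inPn[j jJ jH]] :=
  boolP [forall j in J, (<<row j A>> <= H)%MS].
  have /mxrankS : (span_rows J <= H)%MS by apply/sumsmx_subP.
  by rewrite rJ leqNgt rHd.
(* Since [i] is not in [J], [j] differs from [i]; were [j] in [I], its row would lie in [H]. *)
have ji : j != i by apply: contraNneq iJ => <-.
have jI : j \notin I.
  apply: contra jH => jI; apply: (sumsmx_sup j) => //.
  by rewrite !inE ji.
exists j; first by rewrite inE jI.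
have jn : j \notin I :\ i by rewrite !inE negb_and jI orbT.
have spanE l (K : {set 'I_n}) : l \notin K ->
    span_rows (l |: K) = (<<row l A>> + span_rows K)%MS.
  by move=> lK; rewrite /span_rows big_setU1.
(* Removing one row lowers the rank by at most one. *)
have dH : (d <= (\rank H).+1)%N.
  rewrite -rI -(finset.setD1K iI) spanE ?finset.setD11 ?finset.setD1K //.
  apply: leq_trans (mxrank_adds_leqif _ _).1 _.
  by rewrite -[(\rank H).+1]add1n leq_add2r genmxE rank_leq_row.
apply/eqP; rewrite eqn_leq; apply/andP; split.
  by apply: leq_trans (rank_span_rows _) _; rewrite cardsU1 jn add1n cIi.
apply: leq_trans dH _.
have : (H < span_rows (j |: I :\ i))%MS.
  rewrite /ltmx spanE // addsmxSr /=; apply: contra jH => sub.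
  by apply: submx_trans sub; rewrite addsmxSl.
by rewrite ltmxErank => /andP[].
Qed.

End SpanRows.

Lemma det_rowsub_span_rows (F : fieldType) (n d : nat) (A : 'M[F]_(n, d))
    (f : 'I_d -> 'I_n) (I : {set 'I_n}) :
  I = [set f a | a : 'I_d]%SET ->
  (\det (rowsub f A) != 0) = (\rank (span_rows A I) == d).
Proof.
move=> If; rewrite -(rowsub_span_rows A If) -unitfE.
by rewrite -[_ \is a _]/(rowsub f A \in unitmx) -row_full_unit.
Qed.

(** * Plücker coordinates: the matroid of a subspace and the torus weights *)

Section Plucker.
Variables (R : realType) (n : nat).
Local Notation C := R[i].

Definition basis_mx d (W : grass R n d) : 'M[C]_(d, n) :=
  \matrix_a (vbasis (val W))`_a.

Definition dsubset_fun d (I : dsubset n d) (b : 'I_d) : 'I_n :=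
  enum_val (cast_ord (esym (eqP (valP I))) b).

Lemma dsubset_fun_image d (I : dsubset n d) :
  val I = [set dsubset_fun I b | b : 'I_d]%SET.
Proof.
apply/setP => i; apply/idP/imsetP => [iI|[b _ ->]]; last exact: enum_valP.
exists (cast_ord (eqP (valP I)) (enum_rank_in iI i)) => //.
by rewrite /dsubset_fun cast_ordK enum_rankK_in.
Qed.

Lemma pluckerE d (W : grass R n d) (I : dsubset n d) :
  plucker W I = \det (colsub (dsubset_fun I) (basis_mx W)).
Proof. by congr (\det _); apply/matrixP => a b; rewrite !mxE. Qed.

(** The transpose turns the columns selected by [I] into rows, so that the exchange property of row
    spans applies. *)
Lemma plucker_rank d (W : grass R n d) (I : dsubset n d) :
  (plucker W I != 0) = (\rank (span_rows (basis_mx W)^T (val I)) == d).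
Proof.
rewrite pluckerE -det_tr -(det_rowsub_span_rows _ (dsubset_fun_image I)).
by congr (\det _ != 0); apply/matrixP => a b; rewrite !mxE.
Qed.

Lemma dim_grass d (W : grass R n d) : \dim (val W) = d.
Proof. exact/eqP/(valP W). Qed.

Lemma basis_mx_free d (W : grass R n d) : row_free (basis_mx W).
Proof.
have /freeP fW := basis_free (vbasisP (val W)).
apply: inj_row_free => u uA0; apply/rowP => a; rewrite mxE.
pose dW := dim_grass W.
rewrite -(fW (fun b => u 0 (cast_ord dW b)) _ (cast_ord (esym dW) a)).
  by rewrite cast_ordKV.
rewrite -[RHS]uA0 mulmx_sum_row (reindex (cast_ord dW)) /=.
  by apply: eq_bigr => b _; rewrite rowK.
by exists (cast_ord (esym dW)) => b _; rewrite ?cast_ordK ?cast_ordKV.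
Qed.

Lemma mem_grassP d (W : grass R n d) (v : 'rV_n) :
  reflect (exists u, v = u *m basis_mx W) (v \in val W).
Proof.
apply: (iffP idP) => [vW|[u ->]]; last first.
  rewrite mulmx_sum_row; apply: memv_suml => a _; apply: memvZ.
  by rewrite rowK; apply: vbasis_mem; rewrite mem_nth // size_tuple dim_grass.
exists (\row_a coord (vbasis (val W)) (cast_ord (esym (dim_grass W)) a) v).
rewrite {1}(coord_vbasis vW) mulmx_sum_row.
rewrite (reindex (cast_ord (esym (dim_grass W)))) /=; last first.
  by exists (cast_ord (dim_grass W)) => a _; rewrite ?cast_ordK ?cast_ordKV.
by apply: eq_bigr => a _; rewrite !mxE rowK.
Qed.

Definition plucker_support d (W : grass R n d) : {set {set 'I_n}} :=
  [set I : {set 'I_n} |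
    (#|I| == d) && (\rank (span_rows (basis_mx W)^T I) == d)]%SET.

Lemma plucker_support_matroid d (W : grass R n d) :
  is_matroid d (plucker_support W).
Proof.
apply/and3P; split.
(* The basis matrix has full rank, so [fullrankfun] selects [d] independent columns, which form a
   basis of the matroid. *)
- have ff : row_full (basis_mx W)^T.
    by rewrite /row_full mxrank_tr; exact: basis_mx_free.
  have fi := @fullrankfun_inj _ _ _ _ ff.
  set f := fullrankfun ff in fi.
  apply/set0Pn; exists [set f a | a : 'I_d]%SET; rewrite inE.
  rewrite card_imset // card_ord eqxx /= -(rowsub_span_rows _ erefl).
  exact: (fullrowsub_full).
- by apply/forall_inP => I; rewrite inE => /andP[].
- apply/forall_inP => I; rewrite inE => /andP[/eqP cI /eqP rI].
  apply/forall_inP => J; rewrite inE => /andP[/eqP cJ /eqP rJ].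
  apply/forall_inP => i iIJ.
  have [j jJI rj] := span_rows_exchange cI rI rJ iIJ.
  apply/exists_inP; exists j => //; rewrite inE rj eqxx andbT.
  move: iIJ jJI => /setDP[iI iJ] /setDP[jJ jI].
  rewrite cardsU1 !inE (negPf jI) andbF /= add1n.
  by have := cardsD1 i I; rewrite iI cI add1n => <-.
Qed.

(* [c] is the determinant comparing the basis chosen for [W g] with the image of
   the one chosen for [W]. *)
Lemma plucker_actE d (W : grass R n d) (g : torus R n) :
  exists2 c : C, c != 0 & forall I : dsubset n d,
    plucker (grass_act W g) I =
      c * (\prod_(i in val I) val g i i * plucker W I).
Proof.
have [P PE] : exists P : 'M_d,
    basis_mx (grass_act W g) = P *m (basis_mx W *m val g).
  have row_A' (a : 'I_d) : exists u : 'rV_d,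
      row a (basis_mx (grass_act W g)) = u *m (basis_mx W *m val g).
    have : row a (basis_mx (grass_act W g)) \in val (grass_act W g).
      by apply/mem_grassP; exists (delta_mx 0 a); rewrite rowE.
    move=> /memv_imgP[v /mem_grassP[u ->] ->]; exists u.
    by rewrite lfunE /= mulmxA.
  exists (\matrix_a sval (cid (row_A' a))).
  by apply/row_matrixP => a; rewrite row_mul rowK -(svalP (cid (row_A' a))).
exists (\det P).
  (* [P] is invertible because its product with the translated basis matrix has rank [d]. *)
  rewrite -unitfE -[_ \is a _]/(P \in unitmx) -row_free_unit.
  have := basis_mx_free (grass_act W g); rewrite PE /row_free.
  move=> /eqP rd; rewrite eqn_leq rank_leq_row /= -[X in (X <= _)%N]rd.
  exact: mxrankM_maxl.
move=> I; rewrite !pluckerE PE.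
set f := dsubset_fun I.
have gD : colsub f (basis_mx W *m val g) =
    colsub f (basis_mx W) *m diag_mx (\row_b val g (f b) (f b)).
  have /andP[/is_diag_mxP dg _] := valP g.
  apply/matrixP => a b; rewrite mul_mx_diag !mxE (bigD1 (f b)) //=.
  rewrite big1 ?addr0 ?mxE //.
  by move=> l lb; rewrite dg ?mulr0 // eq_sym.
have -> : colsub f (P *m (basis_mx W *m val g)) =
    P *m colsub f (basis_mx W *m val g).
  by apply/matrixP => a b; rewrite !mxE; apply: eq_bigr => c _; rewrite !mxE.
rewrite gD !det_mulmx det_diag; congr (_ * _); rewrite mulrC; congr (_ * _).
rewrite (dsubset_fun_image I) big_imset /=; last first.
  by move=> a b _ _ /enum_val_inj/cast_ord_inj.
by apply: eq_bigr => b _; rewrite !mxE.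
Qed.

End Plucker.

(** * Continuity of rescalings of multihomogeneous coordinates *)

Section Coordinates.
Variables (R : realType) (I : finType) (B : seq {set I}).
Variables (S : Type) (c : S -> I -> R[i]).
Local Notation C := R[i].
Local Notation T := (coord_space B c).

Lemma open_coord_neq0 (z : I) : open ([set s | c s z != 0] : set T).
Proof.
rewrite zariski_openE; exists [set mpolyX _ (mnm1 (enum_rank z))]; split.
  (* A single variable has degree one in the blocks containing it and degree zero in the others. *)
  move=> _ ->; exists (fun b : {set I} => (z \in b : nat)) => m.
  rewrite msuppX inE => /eqP -> b _.
  have [zb|zb] := boolP (z \in b).
    rewrite (bigD1 z) //= mnm1E eqxx big1 // => i /andP[_ iz].
    by rewrite mnm1E (inj_eq enum_rank_inj) eq_sym (negPf iz).
  rewrite big1 // => i ib.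
  by rewrite mnm1E (inj_eq enum_rank_inj); case: eqVneq ib zb => // -> ->.
apply/seteqP; split=> s /=.
  by move=> sz; eexists => //; rewrite /eval_at mevalXU enum_rankK.
by move=> [_ ->]; rewrite /eval_at mevalXU enum_rankK.
Qed.

Lemma monomial_scale (m : 'I_#|I| -> nat) (mu : {set I} -> C) (x : I -> C) :
  \prod_(j < #|I|)
      ((\prod_(b <- B | enum_val j \in b) mu b) * x (enum_val j)) ^+ m j =
  (\prod_(b <- B) mu b ^+ (\sum_(i in b) m (enum_rank i))) *
    \prod_(j < #|I|) x (enum_val j) ^+ m j.
Proof.
rewrite (eq_bigr _ (fun j _ => exprMn (m j) _ _)) big_split /=; congr (_ * _).
transitivity (\prod_(j < #|I|) \prod_(b <- B | enum_val j \in b) mu b ^+ m j).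
  by apply: eq_bigr => j _; rewrite prodrXl.
rewrite (exchange_big_dep xpredT) //=; apply: eq_bigr => b _.
rewrite -prodrXr (reindex enum_rank) /=; last first.
  by apply: onW_bij; exact: enum_rank_bij.
by apply: eq_bigl => i; rewrite enum_rankK.
Qed.

Variables (phi : S -> S) (a : I -> C).
Hypothesis phi_coord : forall s,
  exists2 mu : {set I} -> C, (forall b, mu b != 0) &
    forall i, c (phi s) i = (\prod_(b <- B | i \in b) mu b) * (a i * c s i).

(** The substitution of [a i * x i] for [x i]. The block factors [mu] vary with the point and so
    cannot enter a polynomial. *)
Definition rescale (p : cpoly R I) : cpoly R I :=
  \sum_(m <- msupp p)
    (mcoeff m p * \prod_(j < #|I|) a (enum_val j) ^+ m j) *: mpolyX _ m.

Lemma rescale_multihomogeneous p e :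
  multihomogeneous B p e -> multihomogeneous B (rescale p) e.
Proof.
move=> hp m /msupp_sum_le /flattenP[_ /mapP[m' + ->]] /msuppZ_le.
by rewrite mem_filter msuppX inE => /= m'p /eqP ->; exact: hp.
Qed.

(** All monomials of [p] have the same degree [e b] in each block [b], so the factors [mu b] come
    out as one common nonzero scalar. *)
Lemma eval_rescale p e s : multihomogeneous B p e ->
  (eval_at c p (phi s) != 0) = (eval_at c (rescale p) s != 0).
Proof.
move=> hp; have [mu mu0 cphi] := phi_coord s.
suff -> : eval_at c p (phi s) =
    (\prod_(b <- B) mu b ^+ e b) * eval_at c (rescale p) s.
  rewrite mulf_eq0 negb_or prodf_seq_neq0.
  by rewrite (_ : all _ _ = true) //; apply/allP => b _; rewrite expf_neq0.
rewrite /eval_at mevalE raddf_sum mulr_sumr /= big_seq [RHS]big_seq.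
apply: eq_bigr => m mp; rewrite mevalZ mevalX -mulrA mulrCA; congr (_ * _).
under eq_bigr do rewrite cphi.
rewrite (monomial_scale m mu (fun i => a i * c s i)); congr (_ * _).
  rewrite big_seq [RHS]big_seq; apply: eq_bigr => b bB.
  by rewrite (hp m mp b bB).
by rewrite -big_split; apply: eq_bigr => j _; rewrite exprMn.
Qed.

Lemma rescale_continuous : continuous (phi : T -> T).
Proof.
apply/continuousP => U; rewrite !zariski_openE => -[P [hP ->]].
exists (rescale @` P); split.
  by move=> _ [p /hP[e he] <-]; exists e; exact: rescale_multihomogeneous.
apply/seteqP; split=> s /=.
  move=> [p Pp ps]; exists (rescale p); first by exists p.
  by have [e he] := hP p Pp; rewrite -(eval_rescale s he).
move=> [_ [p Pp <-] ps]; exists p => //.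
by have [e he] := hP p Pp; rewrite (eval_rescale s he).
Qed.

End Coordinates.

(** * The torus action on flags and cells *)

Section TorusAction.
Variables (R : realType) (n : nat).
Local Notation C := R[i].

Lemma mulg_vspaceM (W : {vspace 'rV[C]_n}) (s g h : torus R n) :
  val h = val s *m val g -> mulg_vspace W h = mulg_vspace (mulg_vspace W s) g.
Proof.
move=> hE; rewrite /mulg_vspace -limg_comp; congr (_ @: _)%VS.
by apply/lfunP => v; rewrite comp_lfunE !lfunE /= hE mulmxA.
Qed.

Lemma mulg_vspace1 (W : {vspace 'rV[C]_n}) (g : torus R n) :
  val g = 1%:M -> mulg_vspace W g = W.
Proof.
move=> gE; rewrite /mulg_vspace -[RHS]lim1g; congr (_ @: _)%VS.
by apply/lfunP => v; rewrite !lfunE /= gE mulmx1.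
Qed.

Lemma is_torus1 : is_torus (1%:M : 'M[C]_n).
Proof. by rewrite /is_torus scalar_mx_is_diag unitmx1. Qed.

Variables (k : nat) (d : 'I_k -> nat).
Local Notation flag := (flag_variety R n d).

Lemma flag_act_ext (w v : flag) (g h : torus R n) :
  (forall i, mulg_vspace (val (flag_comp w i)) g =
             mulg_vspace (val (flag_comp v i)) h) ->
  flag_act w g = flag_act v h.
Proof.
move=> wv; apply: val_inj; apply: functional_extensionality_dep => i.
by apply: val_inj; exact: wv.
Qed.

Lemma thin_actM (M : plurimatroid n d) (w : thin_cell R M) (s g h : torus R n) :
  val h = val s *m val g -> thin_act w h = thin_act (thin_act w s) g.
Proof.
by move=> hE; apply: val_inj; apply: flag_act_ext => i; exact: mulg_vspaceM.
Qed.

Lemma thin_act1 (M : plurimatroid n d) (w : thin_cell R M) (g : torus R n) :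
  val g = 1%:M -> thin_act w g = w.
Proof.
move=> gE; apply: val_inj; apply: val_inj.
apply: functional_extensionality_dep => i.
by apply: val_inj; exact: mulg_vspace1.
Qed.

(** The representative chosen in the coset of [g] differs from [g] by an element of the stabilizer,
    hence acts in the same way. Invariance under the quotient torus thus yields invariance under the
    torus. *)
Lemma torus_quo_act_thin (M : plurimatroid n d) (g : torus R n) :
  exists c : torus_quo R M, forall w : thin_cell R M,
    torus_quo_act R M w c = thin_act w g.
Proof.
pose cosets := range (@coset_stab R n k d M).
have Mg : coset_stab M g \in cosets by apply/mem_set; exists g.
pose c : torus_quo R M := exist (fun c => c \in cosets) _ Mg.
exists c => w; rewrite /torus_quo_act; set h := torus_quo_repr c.
have hg : coset_stab M h = coset_stab M g by exact: s2valP' (cid2 (set_valP c)).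
have : coset_stab M h h.
  exists (exist (@is_torus R n) _ is_torus1); last by rewrite mul1mx.
  by move=> v; exact: thin_act1.
by rewrite hg => -[s sM hE]; rewrite (thin_actM w hE) sM.
Qed.

Lemma plucker_blocks_scale (lam : 'I_k -> C) : (forall i, lam i != 0) ->
  exists2 mu : {set plucker_index n d} -> C, (forall b, mu b != 0) &
    forall z, \prod_(b <- plucker_blocks n d | z \in b) mu b = lam (tag z).
Proof.
move=> lam0.
(* Each index lies in exactly one block, and any element of a block reveals its component. The value
   1 serves for an empty set. *)
exists (fun b : {set plucker_index n d} =>
    if [pick z in b] is Some z then lam (tag z) else 1).
  by move=> b; case: pickP => // *; rewrite ?oner_neq0.
move=> z; rewrite big_map big_enum_cond /= (bigD1 (tag z)) /=; last first.
  by rewrite inE.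
rewrite big1 ?mulr1; last by move=> i /andP[]; rewrite inE eq_sym => ->.
case: pickP => [t|/(_ z)]; rewrite !inE ?eqxx //.
by move=> /eqP ->.
Qed.

(** On Plücker coordinates, [g] multiplies by fixed products of its diagonal entries, up to one
    factor per Grassmannian caused by the choice of bases. *)
Lemma flag_act_continuous (g : torus R n) :
  continuous (fun w : flag => flag_act w g).
Proof.
pose act (W : grass_prod R n d) : grass_prod R n d :=
  fun i => grass_act ((W : forall i, grass R n (d i)) i) g.
have cact : continuous act.
  apply: (@rescale_continuous R (plucker_index n d) (plucker_blocks n d) _
    (@plucker_coord R n k d) act
    (fun z => \prod_(j in val (tagged z)) val g j j)) => W.
  have lamP i := cid2 (plucker_actE (W i) g).
  have [mu mu0 muE] := plucker_blocks_scale (fun i => s2valP (lamP i)).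
  by exists mu => // z; rewrite muE; exact: (s2valP' (lamP (tag z))).
apply/continuousP => U [V oV <-].
exists (act @^-1` V) => //.
by move/continuousP: cact; apply.
Qed.

(** * The generic thin cell of an irreducible set of flags *)

Definition plucker_locus (z : plucker_index n d) : set flag :=
  [set w | plucker (flag_comp w (tag z)) (tagged z) != 0].

Lemma open_plucker_locus z : open (plucker_locus z).
Proof.
exists [set W : grass_prod R n d | plucker_coord W z != 0] => //.
exact: open_coord_neq0.
Qed.

Lemma thin_setP (M : plurimatroid n d) (w : flag) :
  thin_set M w <->
  forall z, plucker_locus z w <-> val (tagged z) \in val (M (tag z)).
Proof.
by split=> [Mw z|Mw i I]; [exact: Mw | exact: Mw (existT _ i I)].
Qed.

(** For irreducible [A], this says that the thin cell of [M] meets [A] in a dense open subset of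
    [A]; it is phrased coordinate by coordinate so as to be visibly open or closed in [A]. *)
Definition generic_cell (M : plurimatroid n d) (A : set flag) : Prop :=
  forall z, A `&` plucker_locus z !=set0 <-> val (tagged z) \in val (M (tag z)).

Lemma generic_cell_exists (A : set flag) : irreducible A ->
  exists M, generic_cell M A.
Proof.
move=> irrA.
have [w [Aw wz]] := irreducible_meet_bigcap irrA
  (P := fun z => `[< A `&` plucker_locus z !=set0 >])
  (fun z Pz => conj (open_plucker_locus z) (asboolW Pz)).
exists (fun i => exist (is_matroid (d i)) _
    (plucker_support_matroid (flag_comp w i))) => z.
have -> : (A `&` plucker_locus z !=set0) <-> plucker_locus z w.
  by split=> [/asboolP/wz//|zw]; exists w.
by rewrite /plucker_locus /= plucker_rank inE (eqP (valP (tagged z))) eqxx.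
Qed.

Lemma generic_cell_unique (A : set flag) M M' :
  generic_cell M A -> generic_cell M' A -> M = M'.
Proof.
move=> MA MA'; apply: functional_extensionality_dep => i; apply: val_inj.
(* Bases have the right cardinality, so each of them indexes a Plücker coordinate. *)
have card (N : matroid n (d i)) J : J \in val N -> #|J| == d i.
  by have /and3P[_ /forall_inP + _] := valP N; apply.
apply/setP => J; apply/idP/idP => JM.
  have /(MA (existT _ i (exist _ J (card _ _ JM)))) := JM.
  by move/(MA' (existT _ i (exist _ J (card _ _ JM)))).
have /(MA' (existT _ i (exist _ J (card _ _ JM)))) := JM.
by move/(MA (existT _ i (exist _ J (card _ _ JM)))).
Qed.

Lemma invariant_pointsP (eta : spoint flag) :
  invariant_points R d eta <->
  forall w g, spoint_set eta w -> spoint_set eta (flag_act w g).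
Proof.
by split=> inv w g; have := inv w g; rewrite !closed_spoint_closure.
Qed.

(** * The image of the map attached to one cell *)

Section Quotient.
Variables (M : plurimatroid n d) (Q : cspace R) (pi : cmor (thin_cell R M) Q).
Hypothesis piQ : geometric_quotient (torus_quo_act R M) pi.

Lemma quotient_thin_act w g : pi (thin_act w g) = pi w.
Proof.
have [c <-] := torus_quo_act_thin M g.
by have [+ _ _ _] := piQ; apply.
Qed.

Lemma Vmap_imageP (eta : spoint flag) :
  Vmap_image pi eta <-> invariant_points R d eta /\ generic_cell M eta.
Proof.
split=> [[y /closure_correspondence etaE]|[/invariant_pointsP inv Meta]].
  split.
    apply/invariant_pointsP => w g; rewrite etaE; move: w.
    (* The flags sent by [g] into the closure form a closed set, which contains the preimage of [y]
       since [pi] is constant on orbits. *)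
    apply: closure_minimal.
      move/continuous_closedP: (@flag_act_continuous g); apply.
      exact: closed_closure.
    move=> _ [e ye <-]; apply: subset_closure.
    by exists (thin_act e g) => //; rewrite /preimage /= quotient_thin_act.
  have cellP (e : thin_set M) z :
      plucker_locus z (set_val e) <-> val (tagged z) \in val (M (tag z)).
    by have /thin_setP := set_valP e; apply.
  move=> z; split=> [[w]|zM].
    rewrite etaE => -[clw zw].
    have /clw : nbhs w (plucker_locus z).
      by apply: open_nbhs_nbhs; split=> //; exact: open_plucker_locus.
    by move=> [_ [[e _ <-] /cellP]].
  (* [y] is nonempty and [pi] is surjective, so some flag of the cell lies over [y]; all coordinates
     in [M] are nonzero there. *)
  have [[q yq] _] := spoint_irr y.
  have [_ [/(_ q)[e eq] _] _ _] := piQ.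
  exists (set_val e); split; last exact/cellP.
  rewrite etaE; apply: subset_closure; exists e => //.
  by rewrite /preimage /= eq.
(* Only the nonvanishing conditions of the cell are kept, which makes [U] open. On [eta] the
   vanishing conditions hold automatically, so [U] and the cell have the same trace. *)
pose U := [set w | forall z : plucker_index n d,
  val (tagged z) \in val (M (tag z)) -> plucker_locus z w].
have oU : open U by apply: open_finite_bigcap => z _; exact: open_plucker_locus.
have etaU : eta `&` U !=set0.
  apply: irreducible_meet_bigcap => [|z zM]; first exact: spoint_irr.
  by split; [exact: open_plucker_locus | exact/Meta].
have etaUM : eta `&` U = eta `&` thin_set M.
  apply/seteqP; split=> w [etaw]; last first.
    by move=> /thin_setP Mw; split=> // z /Mw.
  move=> Uw; split=> //; apply/thin_setP => z; split=> [zw|/Uw//].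
  by apply/Meta; exists w.
pose E : set (thin_cell R M) := set_val @^-1` (eta : set flag).
have irrE : irreducible E :=
  irreducible_preimage_val (spoint_irr eta) oU etaU etaUM.
have cE : closed E.
  have ci : continuous (set_val : thin_set M -> flag).
    exact: initial_continuous.
  by move/continuous_closedP: ci; apply; exact: spoint_closed.
have [_ [_ orb] openQ _] := piQ.
(* [E] is saturated: fibres of [pi] are orbits, and [eta] is invariant. The quotient topology then
   makes its image closed. *)
have piE : pi @^-1` (pi @` E) = E.
  apply/seteqP; split=> [e [e' Ee' /orb[c ->]]|e Ee]; last by exists e.
  exact: inv.
have cpiE : closed (pi @` E).
  by rewrite -openC; apply: openQ; rewrite -preimage_setC piE openC.
exists (SPoint cpiE (irreducible_image (cmor_continuous pi) irrE)).
apply/closure_correspondence; rewrite /= piE.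
have <- := irreducible_dense (@spoint_closed _ eta) (spoint_irr eta) oU etaU.
rewrite etaUM; congr closure; apply/seteqP; split=> w.
  by move=> [etaw Mw]; exists (exist _ w (mem_set Mw)).
by move=> [e Ee <-]; split=> //; exact: (set_valP (e : thin_set M)).
Qed.

End Quotient.

(** * Local closedness and the decomposition *)

Lemma generic_cell_locally_closed (A : set (spoint flag))
    (M : plurimatroid n d) :
  locally_closed ((set_val : A -> spoint flag) @^-1`
    (A `&` [set eta : spoint flag | generic_cell M eta])).
Proof.
pose V z := [set eta : spoint flag | eta `&` plucker_locus z !=set0].
have oV z : open (V z) by apply: open_meet; exact: open_plucker_locus.
pose inM (z : plucker_index n d) := val (tagged z) \in val (M (tag z)).
have cv : continuous (set_val : A -> spoint flag) by exact: initial_continuous.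
exists (set_val @^-1` [set eta | forall z, inM z -> V z eta]).
exists (set_val @^-1` [set eta | forall z, ~~ inM z -> (~` V z) eta]).
split.
- by move/continuousP: cv; apply; apply: open_finite_bigcap.
- move/continuous_closedP: cv; apply.
  rewrite (_ : [set _ | _] = \bigcap_(z in [set z | ~~ inM z]) ~` V z) //.
  by apply: closed_bigI => z _; exact: open_closedC.
apply/seteqP; split=> eta /=.
  move=> [_ Meta]; split=> z; first by move/Meta.
  by move=> zM Vz; move/negP: zM; apply; exact/Meta.
move=> [inV outV]; split; first exact: set_valP.
move=> z; split=> [Vz|/inV//].
by apply: contrapT => /negP/outV; apply.
Qed.

End TorusAction.

Theorem corollary4p7 (R : realType) (n k : nat) (d : 'I_k -> nat)
    (k_gt0 : (0 < k)%N)
    (d_gt0 : forall i, (0 < d i)%N)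
    (d_incr : forall i j : 'I_k, (i < j)%N -> (d i < d j)%N)
    (d_ltn : forall i, (d i < n)%N)
    (Q : plurimatroid n d -> cspace R)
    (pi : forall M : plurimatroid n d, cmor (thin_cell R M) (Q M))
    (piQ : forall M : plurimatroid n d,
        universal_geometric_quotient (torus_quo_act R M) (pi M)) :
  decomposition_of (invariant_points R d)
    (fun M : plurimatroid n d => Vmap_image (pi M)).
Proof.
(* With the images described by generic cells, covering and disjointness become existence and
   uniqueness of the generic cell. *)
have VE M : Vmap_image (pi M) = invariant_points R d `&`
    [set eta : spoint (flag_variety R n d) | generic_cell M eta].
  have [_ quoM _] := piQ M.
  by apply/seteqP; split=> eta /(Vmap_imageP quoM).
split.
- apply/seteqP; split=> [eta inv|eta [M _]]; last by rewrite VE => -[].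
  have [M etaM] := generic_cell_exists (spoint_irr eta).
  by exists M => //; rewrite VE.
- move=> M M' _ _ [eta []]; rewrite !VE => -[_ etaM] [_ etaM'].
  exact: generic_cell_unique etaM etaM'.
- by move=> M; rewrite VE; exact: generic_cell_locally_closed.
Qed.
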